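(* Let $X$ be a compact Hausdorff space. Then the following conditions are equivalent: (a) $X$ is co-absolute with an Eberlein compact; (b) $X$ has a $\sigma$-disjoint $\pi$-base; (c) $X$ is co-absolute with a zero-dimensional Eberlein compact.
   Context: An Eberlein compact is a compact Hausdorff space homeomorphic to a weakly compact subset of a Banach space. Zero-dimensional means having a base of clopen sets. A family $\mathcal{B}$ of open subsets of $X$ is a $\pi$-base of $X$ if for each non-empty open $U\subseteq X$ there is a non-empty $V\in\mathcal{B}$ with $V\subseteq U$. A family is $\sigma$-disjoint if it is a union of countably many families each consisting of pairwise disjoint sets. A map is perfect if it is continuous, closed and has compact point-inverses. A continuous map $f:X\to Y$ is irreducible if $f(X)=Y$ and $f(A)\neq Y$ for each proper closed subset $A$ of $X$. An absolute of a regular space $X$ is an extremally disconnected Tychonoff space $EX$ for which there exists a perfect irreducible map $\pi_X:EX\to X$; it is unique up to homeomorphism. Two regular spaces are co-absolute if their absolutes are homeomorphic. *)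

(* Defs.v *)
From HB Require Import structures.
From mathcomp Require Import all_boot all_order all_algebra.
From mathcomp Require Import all_classical all_reals all_analysis.

Set Implicit Arguments.
Unset Strict Implicit.
Unset Printing Implicit Defensive.

Import Order.TTheory GRing.Theory Num.Theory.
Import numFieldNormedType.Exports.

Local Open Scope classical_set_scope.
Local Open Scope ring_scope.

Definition homeomorphic (X Y : topologicalType) : Prop :=
  exists (f : X -> Y) (g : Y -> X),
    [/\ continuous f, continuous g, cancel f g & cancel g f].

Section WeakTopology.
Context {R : realType} (E : completeNormedModType R).

Definition topological_dual : Type := {f : {linear E -> R^o} | continuous f}.

(* The coarsest topology on the carrier of E making every element of the
   topological dual continuous. *)
Definition weak_topology : topologicalType :=
  sup_topology (fun f : topological_dual =>
    Topological.on (initial_topology (sval f : E -> R^o))).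

End WeakTopology.

(* [set_type K] carries the topology induced on K by the weak topology. *)
Definition eberlein_compact (R : realType) (X : topologicalType) : Prop :=
  [/\ compact [set: X], hausdorff_space X &
    exists (E : completeNormedModType R) (K : set (weak_topology E)),
      compact K /\ homeomorphic X (set_type K)].

(* The library's [zero_dimensional] only asks that distinct points be
   separated by clopen sets, which is weaker outside compact spaces. *)
Definition has_clopen_base (X : topologicalType) : Prop :=
  exists2 B : set (set X), (forall U, B U -> clopen U) & basis B.

Definition pi_base (X : topologicalType) (B : set (set X)) : Prop :=
  B `<=` open /\
  forall U : set X, open U -> U !=set0 ->
    exists V : set X, [/\ B V, V !=set0 & V `<=` U].

Definition sigma_disjoint (X : Type) (B : set (set X)) : Prop :=
  exists F : nat -> set (set X),
    B = \bigcup_n F n /\ forall n, trivIset (F n) id.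

Definition perfect_map (X Y : topologicalType) (f : X -> Y) : Prop :=
  [/\ continuous f,
      forall A : set X, closed A -> closed (f @` A) &
      forall y : Y, compact (f @^-1` [set y])].

Definition irreducible_map (X Y : topologicalType) (f : X -> Y) : Prop :=
  [/\ continuous f, f @` [set: X] = [set: Y] &
      forall A : set X, closed A -> A <> [set: X] -> f @` A <> [set: Y]].

Definition extremally_disconnected (X : topologicalType) : Prop :=
  forall U : set X, open U -> open (closure U).

Definition tychonoff_space (X : topologicalType) : Prop :=
  accessible_space X /\ completely_regular_space X.

Definition is_absolute (X EX : topologicalType) : Prop :=
  [/\ extremally_disconnected EX, tychonoff_space EX &
    exists p : EX -> X, perfect_map p /\ irreducible_map p].

(* Absolutes of regular spaces exist and are unique up to homeomorphism, so
   for such spaces it does not matter which ones are compared. *)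
Definition co_absolute (X Y : topologicalType) : Prop :=
  exists EX EY : topologicalType,
    [/\ is_absolute X EX, is_absolute Y EY & homeomorphic EX EY].

(* Main.v *)
From HB Require Import structures.
Require Import Defs.
From mathcomp Require Import all_boot all_order all_algebra.
From mathcomp Require Import finmap lra.
From mathcomp Require Import all_classical all_reals all_analysis.

(* (a) -> (b): a sigma-disjoint pi-base can be pulled back and pushed forward
   along a perfect irreducible map, so it suffices to find one in a weakly
   compact set K. By the Hahn-Banach theorem K is fragmented by the norm: a
   nonempty open set without small open subsets would contain a Cantor tree of
   open sets whose branches give 2^N cluster points, pairwise far apart in norm
   but in the closed span of countably many points. Hence a maximal disjoint
   family of open sets of diameter at most 1/(n+1) has dense union for each n,
   and by a Baire category argument these families together are a pi-base.

   (b) -> (c): let E be the Iliadis absolute of X, the space of open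
   ultrafilters. For a pi-base that is the union of disjoint families F n, send
   an ultrafilter xi to the function on pairs (n, V) with value 1/(n+1) when V
   is in F n and in xi, and 0 otherwise. At most one value per n is nonzero,
   which makes this map from E to l_infty (in fact to c_0) weakly continuous;
   it is irreducible onto its range because the sets {xi | V in xi}, with V in
   some F n, form a pi-base of E. *)

Set Implicit Arguments.
Unset Strict Implicit.
Unset Printing Implicit Defensive.

Import Order.TTheory GRing.Theory Num.Theory.
Import numFieldNormedType.Exports.

Local Open Scope classical_set_scope.
Local Open Scope ring_scope.

(** * The Hahn-Banach theorem *)

Section HahnBanach.
Context {R : realType} {V : lmodType R}.
Implicit Types (p q : V -> R) (x y z : V).

Definition sublinear p :=
  (forall x y, p (x + y) <= p x + p y) /\
  (forall (t : R) x, 0 <= t -> p (t *: x) = t * p x).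

Lemma sublinear0 p : sublinear p -> p 0 = 0.
Proof. by move=> [_ pZ]; rewrite -(scale0r 0) pZ// mul0r. Qed.

Lemma sublinear_geN p x : sublinear p -> - p (- x) <= p x.
Proof.
move=> sp; have := sp.1 x (- x); rewrite subrr sublinear0//.
by rewrite -lerBlDr sub0r.
Qed.

(** The inequality for [t^-1] at [t *: x] is the reverse inequality for [t] at [x]. *)
Lemma sublinearW p : p 0 = 0 -> (forall x y, p (x + y) <= p x + p y) ->
  (forall (t : R) x, 0 < t -> p (t *: x) <= t * p x) -> sublinear p.
Proof.
move=> p0 pD pZ; split=> // t x; rewrite le_eqVlt => /predU1P[<-|t0].
  by rewrite scale0r p0 mul0r.
apply/eqP; rewrite eq_le pZ//=.
have := pZ t^-1 (t *: x); rewrite invr_gt0 => /(_ t0).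
by rewrite scalerA mulVf ?gt_eqF// scale1r ler_pdivlMl.
Qed.

Lemma le_inf_add (A B : set R) (c : R) : A !=set0 -> B !=set0 ->
  (forall a b, A a -> B b -> c <= a + b) -> c <= inf A + inf B.
Proof.
move=> A0 B0 cAB; rewrite -lerBlDr; apply: lb_le_inf => // a Aa.
rewrite lerBlDr -lerBlDl; apply: lb_le_inf => // b Bb.
by rewrite lerBlDl; exact: cAB.
Qed.

(* Lowering a sublinear function so that it becomes linear on the line through
   [z]; a minimal sublinear function is fixed by this for every [z]. *)
Lemma sublinear_lower q z : sublinear q ->
  exists r, [/\ sublinear r, forall x, r x <= q x & r (- z) <= - q z].
Proof.
move=> sq; pose S x := [set q (x + t *: z) - t * q z | t in [set t | 0 <= t]].
have S0 x : S x !=set0 by exists (q (x + 0 *: z) - 0 * q z), 0 => /=.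
have lbS x : lbound (S x) (- q (- x)).
  (* [t *: z] is the sum of [x + t *: z] and [- x], so subadditivity bounds [S x] from below. *)
  move=> _ [t /= t0 <-]; rewrite -sq.2// lerBrDr addrC lerBlDr.
  by rewrite (le_trans _ (sq.1 _ _))// (addrC x) addrK.
have hS x : has_lbound (S x) by exists (- q (- x)).
have Sq x t : 0 <= t -> inf (S x) <= q (x + t *: z) - t * q z.
  by move=> t0; apply: ge_inf => //; exists t.
have Slt x : inf (S x) <= q x.
  by have := Sq x 0 (lexx _); rewrite scale0r addr0 mul0r subr0.
exists (fun x => inf (S x)); split => //; last first.
  (* The parameter [t = 1] gives [q 0 - q z]. *)
  by have := Sq (- z) 1 ler01; rewrite scale1r addNr sublinear0// mul1r sub0r.
apply: sublinearW.
- apply/eqP; rewrite eq_le; apply/andP; split.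
    by rewrite -[leRHS](sublinear0 sq).
  by apply: lb_le_inf => //; have := lbS 0; rewrite oppr0 sublinear0// oppr0.
- move=> x y; apply: le_inf_add => // _ _ [s /= s0 <-] [t /= t0 <-].
  apply: (le_trans (Sq _ (s + t) (addr_ge0 s0 t0))).
  rewrite scalerDl addrACA mulrDl opprD [leRHS]addrACA lerD2r.
  exact: sq.1.
- move=> c x c0; rewrite -ler_pdivrMl//; apply: lb_le_inf => // _ [t /= t0 <-].
  rewrite ler_pdivrMl//; apply: (le_trans (Sq _ (c * t) _)).
    by rewrite mulr_ge0// ltW.
  by rewrite -scalerA -scalerDr sq.2 ?(ltW c0)// -mulrA -mulrBr.
Qed.

(** Zorn's lemma for the reversed pointwise order: a nonempty chain is bounded by its pointwise
    infimum, which is finite because every member is at least [- p (- x)] at [x]. *)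
Lemma minimal_sublinear p : sublinear p ->
  exists q, [/\ sublinear q, forall x, q x <= p x &
    forall r, sublinear r -> (forall x, r x <= q x) -> r = q].
Proof.
move=> sp; pose T := {q : V -> R | sublinear q /\ forall x, q x <= p x}.
pose le (q r : T) := `[< forall x, sval r x <= sval q x >].
have [||||[q [sq qp]] qmin] := @Zorn T le.
- by move=> q; apply/asboolP => x.
- move=> q r s /asboolP qr /asboolP rs; apply/asboolP => x.
  exact: le_trans (rs x) (qr x).
- move=> [q ?] [r ?] /asboolP /= qr /asboolP /= rq.
  by apply/eq_exist/funext => x; apply/le_anti; rewrite rq qr.
- move=> A totA; have [[q0 Aq0]|A0] := pselect (A !=set0); last first.
    exists (exist _ p (conj sp (fun=> lexx _))) => q Aq.
    by exfalso; apply: A0; exists q.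
  pose S x := [set sval q x | q in A].
  have S0 x : S x !=set0 by exists (sval q0 x), q0.
  have lbS x : lbound (S x) (- p (- x)).
    move=> _ [[q [sq qp]] Aq <-] /=; apply: le_trans (sublinear_geN x sq).
    by rewrite lerN2.
  have Sq (q : T) x : A q -> inf (S x) <= sval q x.
    by move=> Aq; apply: ge_inf; [exists (- p (- x))|exists q].
  have sS : sublinear (fun x => inf (S x)).
    apply: sublinearW.
    + apply/eqP; rewrite eq_le; apply/andP; split.
        by rewrite -[leRHS](sublinear0 (svalP q0).1); exact: Sq.
      apply: lb_le_inf => // _ [q Aq <-].
      by rewrite (sublinear0 (svalP q).1).
    + move=> x y; apply: le_inf_add => // _ _ [q Aq <-] [r Ar <-].
      (* Of two members of the chain, the smaller one serves for both summands. *)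
      have [/asboolP qr|/asboolP rq] := totA _ _ Aq Ar.
      * apply: (le_trans (Sq _ _ Ar)); apply: (le_trans ((svalP r).1.1 _ _)).
        by rewrite lerD2r.
      * apply: (le_trans (Sq _ _ Aq)); apply: (le_trans ((svalP q).1.1 _ _)).
        by rewrite lerD2l.
    + move=> c x c0; rewrite -ler_pdivrMl//; apply: lb_le_inf => // _ [q Aq <-].
      by rewrite ler_pdivrMl// -(svalP q).1.2 ?(ltW c0)//; exact: Sq.
  have Sp x : inf (S x) <= p x.
    exact: (le_trans (Sq _ _ Aq0) ((svalP q0).2 x)).
  exists (exist _ (fun x => inf (S x)) (conj sS Sp)) => q Aq.
  by apply/asboolP => x; exact: Sq.
- exists q; split=> // r sr rq.
  have rp x : r x <= p x by exact: le_trans (rq x) (qp x).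
  have := qmin (exist _ r (conj sr rp)) => /(_ _)/(congr1 sval) /= -> //.
  exact/asboolP.
Qed.

(** A minimal sublinear function is unchanged by lowering along any vector, hence odd, hence linear.
    Lowering [p] along [x0] beforehand forces the value [p x0] at [x0]. *)
Theorem hahn_banach p x0 : sublinear p ->
  exists f : {linear V -> R^o}, (forall x, f x <= p x) /\ f x0 = p x0.
Proof.
move=> /(sublinear_lower x0)[p' [sp' p'p p'x0]].
have [q [sq qp' qmin]] := minimal_sublinear sp'.
have qN x : q (- x) = - q x.
  have [r [sr rq rx]] := sublinear_lower x sq.
  move: rx; rewrite (qmin r sr rq) => rx; apply/le_anti; rewrite rx/=.
  by rewrite lerNl -[leRHS]/(q x) sublinear_geN.
have qD : {morph q : x y / x + y}.
  move=> x y; apply/le_anti; rewrite sq.1/= -lerN2 -qN opprD.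
  by rewrite (le_trans (sq.1 _ _))// !qN opprD.
have lq : linear_for *%R q.
  move=> a x y; rewrite qD; congr (_ + _).
  have [a0|a0] := leP 0 a; first exact: sq.2.
  by rewrite -[a]opprK scaleNr qN sq.2 ?mulNr// oppr_ge0 ltW.
pose f : {linear V -> R^o} := HB.pack (q : V -> R^o)
  (GRing.isLinear.Build R V R^o *:%R (q : V -> R^o) lq).
exists f; split=> [x|]; first exact: le_trans (qp' x) (p'p x).
apply/le_anti; rewrite (le_trans (qp' x0)) ?p'p//=.
by rewrite -[_ <= _]lerN2 -[- f x0]qN (le_trans (qp' _)).
Qed.

End HahnBanach.

(** * Transfer of pi-bases along irreducible maps *)

Definition has_sigma_disjoint_pi_base (X : topologicalType) :=
  exists B : set (set X), pi_base B /\ sigma_disjoint B.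

(** It is enough that [g] creates no new intersections: members of one disjoint family whose images
    meet coincide. *)
Lemma sigma_disjoint_image (X Y : Type) (g : set X -> set Y) (B : set (set X)) :
  (forall U V, B U -> B V -> g U `&` g V !=set0 -> U `&` V !=set0) ->
  sigma_disjoint B -> sigma_disjoint [set g U | U in B].
Proof.
move=> gI [F [BF tF]]; exists (fun n => [set g U | U in F n]).
have FB n : F n `<=` B by rewrite BF; exact: bigcup_sup.
split; first by rewrite BF image_bigcup.
move=> n _ _ [U FU <-] [V FV <-] /= /(gI _ _ (FB _ _ FU) (FB _ _ FV)) UV.
by rewrite (tF n U V FU FV UV).
Qed.

Lemma sigma_disjoint_pi_base_preimage (X Y : topologicalType) (f : X -> Y) :
  continuous f -> f @` [set: X] = [set: Y] ->
  (forall U, open U -> U !=set0 ->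
    exists W, [/\ open W, W !=set0 & f @^-1` W `<=` U]) ->
  has_sigma_disjoint_pi_base Y -> has_sigma_disjoint_pi_base X.
Proof.
move=> cf fT fU [B [[Bo Bpi] sB]]; exists [set f @^-1` V | V in B]; split.
  split=> [_ [V BV <-]|U oU U0].
    by move/continuousP : cf; apply; exact: Bo.
  have [W [oW W0 WU]] := fU U oU U0.
  have [V [BV [y Vy] VW]] := Bpi W oW W0.
  exists (f @^-1` V); split; first by exists V.
    have : [set: Y] y by [].
    by rewrite -fT => -[x _ fx]; exists x; rewrite /preimage/= fx.
  by move=> x /VW /WU.
by apply: sigma_disjoint_image => // U V _ _ [x [Ux Vx]]; exists (f x).
Qed.

Section irreducible.
Context {X Y : topologicalType} {f : X -> Y}.
Hypotheses (pf : perfect_map f) (irf : irreducible_map f).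

(** The points whose whole fibre lies in [U]. For a closed map this set is open when [U] is, whereas
    the image of [U] need not be. *)
Definition small_image (U : set X) : set Y := ~` (f @` (~` U)).

Let fS y : exists x, f x = y.
Proof.
have [_ fT _] := irf; have : [set: Y] y by [].
by rewrite -fT => -[x _ <-]; exists x.
Qed.

Lemma open_small_image U : open U -> open (small_image U).
Proof. by case: pf => _ fcl _ oU; apply/closed_openC/fcl/open_closedC. Qed.

Lemma small_image_neq0 U : open U -> U !=set0 -> small_image U !=set0.
Proof.
move=> oU [x Ux]; have [_ _ firr] := irf.
have : f @` (~` U) <> setT.
  apply: firr; first exact: open_closedC.
  by move=> /seteqP[_ /(_ x I)].
by move=> /eqP/setTPn[y ny]; exists y.
Qed.

Lemma preimage_small_image U : f @^-1` (small_image U) `<=` U.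
Proof. by move=> x /= nx; apply: contrapT => Ux; apply: nx; exists x. Qed.

(** Small images of disjoint sets are disjoint, because the fibre over a common point is nonempty
    and lies in both sets. *)
Lemma irreducible_pi_base_push :
  has_sigma_disjoint_pi_base X -> has_sigma_disjoint_pi_base Y.
Proof.
move=> [B [[Bo Bpi] sB]]; exists [set small_image V | V in B]; split.
  split=> [_ [V BV <-]|W oW [y Wy]].
    by apply: open_small_image; exact: Bo.
  have [cf _ _] := irf.
  have [V [BV V0 VW]] : exists V, [/\ B V, V !=set0 & V `<=` f @^-1` W].
    apply: Bpi; first by move/continuousP : cf; apply.
    by have [x fxy] := fS y; exists x; rewrite /preimage/= fxy.
  exists (small_image V); split; first by exists V.
    by apply: small_image_neq0 => //; exact: Bo.
  move=> z sz; have [x fxz] := fS z; subst z.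
  by apply: VW; exact: preimage_small_image sz.
apply: sigma_disjoint_image => // U V BU BV [y [Uy Vy]]; have [x fxy] := fS y.
subst y; exists x.
by split; [exact: preimage_small_image Uy|exact: preimage_small_image Vy].
Qed.

Lemma irreducible_pi_base_pull :
  has_sigma_disjoint_pi_base Y -> has_sigma_disjoint_pi_base X.
Proof.
have [cf fT _] := irf; apply: sigma_disjoint_pi_base_preimage cf fT _.
move=> U oU U0; exists (small_image U); split.
- exact: open_small_image.
- exact: small_image_neq0.
- exact: preimage_small_image.
Qed.

End irreducible.

Lemma homeomorphic_pi_base (X Y : topologicalType) : homeomorphic X Y ->
  has_sigma_disjoint_pi_base Y -> has_sigma_disjoint_pi_base X.
Proof.
move=> [f [g [cf cg fK gK]]]; apply: (sigma_disjoint_pi_base_preimage cf).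
  by apply/seteqP; split=> // y _; exists (g y).
move=> U oU [x Ux]; exists (g @^-1` U); split.
- by move/continuousP : cg; apply.
- by exists (f x); rewrite /preimage/= fK.
- by move=> z; rewrite /preimage/= fK.
Qed.

Lemma co_absolute_pi_base (X Y : topologicalType) : co_absolute X Y ->
  has_sigma_disjoint_pi_base Y -> has_sigma_disjoint_pi_base X.
Proof.
move=> [EX [EY [[_ _ [p [pp ip]]] [_ _ [q [pq iq]]] hXY]]] hY.
apply: (irreducible_pi_base_push pp ip); apply: (homeomorphic_pi_base hXY).
exact: (irreducible_pi_base_pull pq iq).
Qed.

(** * Fragmentability of weakly compact sets *)

(** Cantor's diagonal argument: [t] differs from every [s] at the position [pickle (c s)]. *)
Lemma no_injection_cantor (C : countType) (c : (nat -> bool) -> C) :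
  ~ injective c.
Proof.
move=> ic; pose t n := `[< forall s, choice.pickle (c s) = n -> s n = false >].
have [tt|tf] := boolP (t (choice.pickle (c t))).
  by move/asboolP : (tt) => /(_ t erefl); rewrite tt.
move/asboolP: (tf); apply=> s /(pcan_inj choice.pickleK) /ic ->.
exact/negbTE.
Qed.

Lemma exists_cluster_point (Y : topologicalType) (w : nat -> Y) :
  compact [set: Y] -> exists y, forall O, open O -> O y ->
    forall n, exists2 m, (n <= m)%N & O (w m).
Proof.
move=> cY; have [|y [_ yc]] := cY (w @ \oo) _; first exact: filterT.
exists y => O oO Oy n.
have : (w @ \oo) [set w m | m in [set m | (n <= m)%N]].
  by exists n => // m nm; exists m.
move=> /yc /(_ (open_nbhs_nbhs (conj oO Oy)))[_ [[m nm <-] Om]].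
by exists m.
Qed.

Lemma open_shrink (Y : topologicalType) (y : Y) (U : set Y) :
  compact [set: Y] -> hausdorff_space Y -> open U -> U y ->
  exists V, [/\ open V, V y & closure V `<=` U].
Proof.
move=> cY hY oU Uy.
have := @compact_regular Y y setT hY cY filterT _ (open_nbhs_nbhs (conj oU Uy)).
move=> [W + WU]; rewrite nbhsE => -[V [oV Vy] VW].
by exists V; split=> //; apply: subset_trans WU; exact: closureS.
Qed.

(** * Functionals separating a point from a rational span *)

Section rational_span.
Context {R : realType} {E : normedModType R} {I : Type} (d : I -> E).

(** Coefficients are rational so that the lists form a countable type when [I] is countable, as the
    counting of branches requires. *)
Definition rat_comb (c : seq (rat * I)) : E :=
  \sum_(qi <- c) ratr qi.1 *: d qi.2.

Lemma rat_comb_cat c1 c2 : rat_comb (c1 ++ c2) = rat_comb c1 + rat_comb c2.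
Proof. exact: big_cat. Qed.

Lemma rat_combZ (q : rat) c :
  rat_comb [seq (q * qi.1, qi.2) | qi <- c] = ratr q *: rat_comb c.
Proof.
rewrite /rat_comb big_map scaler_sumr; apply: eq_bigr => qi _ /=.
by rewrite rmorphM scalerA.
Qed.

Definition rat_dist (x : E) : R := inf [set `|x - rat_comb c| | c in setT].

Lemma rat_dist_le x c : rat_dist x <= `|x - rat_comb c|.
Proof.
apply: ge_inf; last by exists c.
by exists 0 => _ [c' _ <-]; exact: normr_ge0.
Qed.

Lemma le_rat_dist x (e : R) : (forall c, e <= `|x - rat_comb c|) ->
  e <= rat_dist x.
Proof.
move=> ex; apply: lb_le_inf; first by exists `|x - rat_comb [::]|, [::].
by move=> _ [c _ <-].
Qed.

Lemma rat_dist_comb c : rat_dist (rat_comb c) = 0.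
Proof.
apply/le_anti; have := rat_dist_le (rat_comb c) c.
by rewrite subrr normr0 => ->; apply: le_rat_dist => c'.
Qed.

Lemma sublinear_rat_dist : sublinear rat_dist.
Proof.
apply: sublinearW.
- by have := rat_dist_comb [::]; rewrite /rat_comb big_nil.
- move=> x y; apply: le_inf_add.
  + by exists `|x - rat_comb [::]|, [::].
  + by exists `|y - rat_comb [::]|, [::].
  + move=> _ _ [c _ <-] [c' _ <-]; apply: le_trans (rat_dist_le _ (c ++ c')) _.
    by rewrite rat_comb_cat opprD addrACA ler_normD.
- move=> t x t0; rewrite -ler_pdivrMl//; apply: le_rat_dist => c.
  rewrite ler_pdivrMl//; apply/ler_addgt0Pr => e e0.
  (* A rational [q] slightly above [t] replaces it at a cost of at most [e]; the summand 1 in [n]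
     avoids division by zero. *)
  set u := rat_comb c; pose n := `|u| + 1.
  have n0 : 0 < n by rewrite ltr_wpDl.
  have [q tq qt] : exists2 q : rat, t < ratr q & ratr q < t + e / n.
    have /rat_in_itvoo[q] : t < t + e / n by rewrite ltrDl divr_gt0.
    by rewrite in_itv/= => /andP[? ?]; exists q.
  apply: le_trans (rat_dist_le _ [seq (q * qi.1, qi.2) | qi <- c]) _.
  rewrite rat_combZ -/u.
  have -> : t *: x - ratr q *: u = t *: (x - u) + (t - ratr q) *: u.
    by rewrite scalerBr scalerBl addrA subrK.
  apply: le_trans (ler_normD _ _) _; rewrite !normrZ gtr0_norm// lerD2l.
  apply: (@le_trans _ _ ((e / n) * n)); last by rewrite divfK// gt_eqF.
  apply: ler_pM => //; last by rewrite lerDl.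
  by rewrite ltr0_norm ?subr_lt0// opprB lerBlDl ltW.
Qed.

(** Hahn-Banach is applied below [rat_dist], which vanishes at every rational multiple of [d i].
    This squeezes [f (d i)] to 0, while [f v] is the distance of [v] from the combinations. *)
Lemma separating_functional v (e : R) : 0 < e ->
  (forall c, e <= `|v - rat_comb c|) ->
  exists f : {linear E -> R^o},
    [/\ forall x, f x <= `|x|, forall i, f (d i) = 0 & 0 < f v].
Proof.
move=> e0 ve; have [f [fp fv]] := hahn_banach v sublinear_rat_dist.
have d0 (q : rat) i : rat_dist (ratr q *: d i) = 0.
  by rewrite -(rat_dist_comb [:: (q, i)]) /rat_comb big_seq1.
exists f; split.
- move=> x; apply: le_trans (fp x) _; apply: le_trans (rat_dist_le _ [::]) _.
  by rewrite /rat_comb big_nil subr0.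
- move=> i; apply/le_anti.
  have := fp (ratr 1 *: d i); have := fp (ratr (-1) *: d i).
  by rewrite !d0 rmorphN !rmorph1 scaleN1r scale1r linearN oppr_le0 => -> ->.
- by rewrite fv (lt_le_trans e0)//; exact: le_rat_dist.
Qed.

End rational_span.

Lemma norming_functional (R : realType) (E : normedModType R) (v : E) :
  exists f : {linear E -> R^o}, (forall x, f x <= `|x|) /\ f v = `|v|.
Proof.
apply: (hahn_banach v (p := fun x => `|x|)); split; first exact: ler_normD.
by move=> t x t0; rewrite normrZ ger0_norm.
Qed.

(** * Fragmentation by the norm and the resulting pi-base *)

Section fragmentability.
Context {R : realType} {E : normedModType R} {Y : topologicalType} (j : Y -> E).
Hypotheses (cY : compact [set: Y]) (hY : hausdorff_space Y).
Hypothesis weak_continuous : forall f : {linear E -> R^o},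
  (forall x, f x <= `|x|) -> continuous (f \o j : Y -> R^o).

Lemma open_preimage_gt (f : {linear E -> R^o}) (r : R) :
  (forall x, f x <= `|x|) -> open [set y | r < f (j y)].
Proof.
move=> /weak_continuous/continuousP/(_ [set x | r < x]); apply.
exact: open_gt.
Qed.

Lemma open_preimage_lt (f : {linear E -> R^o}) (r : R) :
  (forall x, f x <= `|x|) -> open [set y | f (j y) < r].
Proof.
move=> /weak_continuous/continuousP/(_ [set x | x < r]); apply.
exact: open_lt.
Qed.

(** A norming functional of [j a - j b] puts the two points into half-spaces whose values differ by
    more than [e]; regularity then shrinks these open sets so that the closures stay inside. *)
Lemma split_open (e : R) (U : set Y) a b : open U -> U a -> U b ->
  e < `|j a - j b| ->
  exists V : bool -> set Y,
    (forall i, [/\ open (V i), V i !=set0 & closure (V i) `<=` U]) /\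
    (forall x y, closure (V true) x -> closure (V false) y -> e < `|j x - j y|).
Proof.
move=> oU Ua Ub eab; have [f [f1 fab]] := norming_functional (j a - j b).
rewrite -fab linearB/= in eab.
(* The midpoint of [f (j b) + e] and [f (j a)]. *)
pose m := (f (j a) + f (j b) + e) / 2.
have ma : m < f (j a) by rewrite /m; lra.
have mb : f (j b) < m - e by rewrite /m; lra.
have [V [oV Va VU]] :=
  open_shrink cY hY (openI oU (open_preimage_gt m f1)) (conj Ua ma).
have [W [oW Wb WU]] :=
  open_shrink cY hY (openI oU (open_preimage_lt (m - e) f1)) (conj Ub mb).
exists (fun i => if i then V else W); split.
  case; split=> //.
  - by exists a.
  - by move=> x /VU[].
  - by exists b.
  - by move=> x /WU[].
move=> x y /VU[_ /= mx] /WU[_ /= my]; apply: lt_le_trans (f1 _).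
by rewrite linearB/=; lra.
Qed.

(** The first [n] bits of [s], latest bit first, to match the order in which [foldr] descends the
    tree. *)
Fixpoint branch (s : nat -> bool) n :=
  if n is m.+1 then s m :: branch s m else [::].

(** Otherwise repeated splitting gives a binary tree [T]. Each branch has a cluster point within
    [e / 2] of a rational combination of the points [x_]. Branches sharing a combination have
    cluster points less than [e] apart, so they never split, and the branches would inject into a
    countable type. *)
Lemma weakly_compact_fragmented (e : R) (U : set Y) : 0 < e ->
  open U -> U !=set0 ->
  exists V, [/\ open V, V !=set0, V `<=` U &
    forall x y, V x -> V y -> `|j x - j y| <= e].
Proof.
move=> e0 oU U0; apply: contrapT => noV.
pose good V := [/\ open V, V !=set0 & V `<=` U].
have /choice[S SP] : forall V : set Y, exists S : bool -> set Y, good V ->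
    (forall i, good (S i) /\ closure (S i) `<=` V) /\
    (forall x y, closure (S true) x -> closure (S false) y -> e < `|j x - j y|).
  move=> V; have [[oV V0 VU]|?] := pselect (good V); last first.
    by exists (fun=> set0).
  have [a [b [Va Vb ab]]] : exists a b, [/\ V a, V b & e < `|j a - j b|].
    apply: contrapT => nab; apply: noV; exists V; split=> // x y Vx Vy.
    by rewrite leNgt; apply/negP => xy; apply: nab; exists x, y.
  have [S [S1 S2]] := split_open oV Va Vb ab; exists S => _; split=> // i.
  have [? ? SV] := S1 i; split=> //; split=> //.
  by apply: subset_trans VU; apply: subset_trans SV; exact: subset_closure.
pose T := foldr (fun i V => S V i) U.
have gT s : good (T s) by elim: s => [|i s /SP[/(_ i)[]] //]; split.
have /choice[x_ Tx] : forall s, exists x, T s x by move=> s; have [] := gT s.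
have Tbranch s m n : (n <= m)%N -> T (branch s m) `<=` T (branch s n).
  elim: m => [|m IH]; first by rewrite leqn0 => /eqP ->.
  rewrite leq_eqVlt ltnS => /predU1P[-> //|/IH]; apply: subset_trans => /=.
  have [/(_ (s m))[_ SV] _] := SP _ (gT (branch s m)).
  by apply: subset_trans SV; exact: subset_closure.
have /choice[y_ yP] : forall s : nat -> bool, exists y,
    forall O, open O -> O y ->
    forall n, exists2 m, (n <= m)%N & O (x_ (branch s m)).
  by move=> s; exact: exists_cluster_point.
have Ty s n : closure (T (branch s n)) (y_ s).
  move=> A; rewrite nbhsE => -[B [oB By] BA].
  have [m nm Bm] := yP s B oB By n.
  exists (x_ (branch s m)); split; last exact: BA.
  exact: Tbranch nm _ (Tx _).
(* A functional vanishing on all [j (x_ u)] but positive at [j (y_ s)] would give [y_ s] a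
   neighbourhood free of the points that cluster at it. *)
have /choice[c cP] : forall s, exists c,
    `|j (y_ s) - rat_comb (j \o x_) c| < e / 2.
  move=> s; apply: contrapT => nc.
  have [||f [f1 fx fy]] :=
    @separating_functional _ _ _ (j \o x_) (j (y_ s)) (e / 2).
  - by rewrite divr_gt0.
  - by move=> c; rewrite leNgt; apply/negP => ?; apply: nc; exists c.
  have [m _ /=] := yP s _ (open_preimage_gt 0 f1) fy 0%N.
  by have /= -> := fx (branch s m); rewrite ltxx.
apply: (@no_injection_cantor _ c) => s t cst.
have {}cst : `|j (y_ s) - j (y_ t)| < e.
  rewrite -(subrK (rat_comb (j \o x_) (c s)) (j (y_ s))) -addrA.
  apply: le_lt_trans (ler_normD _ _) _; rewrite [ltRHS]splitr ltrD//.
  by rewrite cst distrC.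
(* After equal prefixes, unequal next bits would place the cluster points in closures more than [e]
   apart. *)
suff bst n : branch s n = branch t n.
  by apply/funext => n; have := bst n.+1 => -[].
elim: n => [//|n IHn] /=; rewrite IHn.
have [_ sep] := SP _ (gT (branch t n)).
have := Ty s n.+1; have := Ty t n.+1; rewrite /= IHn.
case: (s n); case: (t n) => // yt ys; exfalso.
- by have := lt_trans (sep _ _ ys yt) cst; rewrite ltxx.
- by have := sep _ _ yt ys; rewrite distrC => /lt_trans/(_ cst); rewrite ltxx.
Qed.

(* Along a decreasing sequence of open sets, the [n]-th one inside a member of
   the [n]-th maximal family, the limit point is surrounded by members of
   arbitrarily small diameter. *)
Lemma fragmented_pi_base :
  (forall U y, open U -> U y ->
    exists2 e : R, 0 < e & forall z, `|j z - j y| < e -> U z) ->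
  has_sigma_disjoint_pi_base Y.
Proof.
move=> fine.
pose small n := [set V : set Y | [/\ open V, V !=set0 &
  forall x y, V x -> V y -> `|j x - j y| <= n.+1%:R^-1]].
have /choice[F FP] : forall n, exists F,
    maximal_disjoint_subcollection (id : set Y -> set Y) F (small n).
  move=> n; have [F] := ex_maximal_disjoint_subcollection id (small n).
  by exists F.
(* The union of [F n] is dense: a small open subset of [U] missing all members could be added,
   against maximality. *)
have Fmeet n U : open U -> U !=set0 -> exists2 V, F n V & (U `&` V) !=set0.
  move=> oU U0; apply: contrapT => nV.
  have e0 : 0 < n.+1%:R^-1 :> R by rewrite invr_gt0.
  have [W [oW W0 WU Wn]] := weakly_compact_fragmented e0 oU U0.
  have [Fsmall Ftriv Fmax] := FP n.
  have WV V : F n V -> W `&` V !=set0 -> False.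
    move=> FV [x [Wx Vx]]; apply: nV; exists V => //.
    by exists x; split=> //; exact: WU.
  apply: (Fmax (F n `|` [set W])).
  - split; first exact: subsetUl.
    by move=> /(_ W (or_intror erefl)) FW; apply: (WV W FW); rewrite setIid.
  - by move=> V [/Fsmall//|->].
  - move=> A B [FA|->] [FB|->] //= AB; first exact: Ftriv.
    + by exfalso; apply: (WV A FA); rewrite setIC.
    + by exfalso; apply: (WV B FB).
exists (\bigcup_n F n); split; last first.
  by exists F; split=> // n; have [] := FP n.
have Fsmall n V : F n V -> small n V by have [+ _ _] := FP n; apply.
split=> [V [n _ /Fsmall[]//]|U oU U0].
pose good (V : set Y) := open V /\ V !=set0.
(* For nonempty open [V], [st (n, V)] is a nonempty open set whose closure lies in [V] and in a
   member of [F n]. *)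
have /choice[st stP] : forall nV : nat * set Y, exists W, good nV.2 ->
    good W /\ exists2 V, F nV.1 V & closure W `<=` nV.2 `&` V.
  move=> [n V] /=; have [[oV V0]|?] := pselect (good V); last by exists V.
  have [A FA [x [Vx Ax]]] := Fmeet n V oV V0.
  have oA : open A by have [] := Fsmall _ _ FA.
  have [W [oW Wx WVA]] := open_shrink cY hY (openI oV oA) (conj Vx Ax).
  by exists W => _; split; [split=> //; exists x|exists A].
pose W := fix W n := if n is m.+1 then st (m, W m) else U.
have gW n : good (W n) by elim: n => [//|n gW]; have [] := stP (n, W n) gW.
have WS n : closure (W n.+1) `<=` W n.
  by have [_ [V _ WV]] := stP (n, W n) (gW n) => x /WV[].
have Wle m n : (n <= m)%N -> W m `<=` W n.
  elim: m => [|m IH]; first by rewrite leqn0 => /eqP ->.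
  rewrite leq_eqVlt ltnS => /predU1P[-> //|/IH]; apply: subset_trans.
  by apply: subset_trans (WS m); exact: subset_closure.
have /choice[w Ww] : forall n, exists x, W n x by move=> n; have [] := gW n.
have [y yP] := exists_cluster_point w cY.
have Wy n : closure (W n) y.
  move=> A; rewrite nbhsE => -[B [oB By] BA].
  have [m nm Bm] := yP B oB By n.
  by exists (w m); split; [exact: Wle nm _ (Ww m)|exact: BA].
(* [W 0] is [U], so the closure of [W 1] already puts [y] inside [U]. *)
have [e e0 eU] := fine U y oU (WS 0%N _ (Wy 1%N)).
have [n ne] : exists n, n.+1%:R^-1 < e.
  have /cvgrPdist_lt/(_ e e0)[n _ /(_ n (leqnn n))/=] := @cvg_harmonic R.
  by rewrite sub0r normrN ger0_norm// => ne; exists n.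
have [_ [V FV WV]] := stP (n, W n) (gW n).
have [oV V0 Vn] := Fsmall _ _ FV.
exists V; split=> //; first by exists n.
move=> z Vz; apply: eU; apply: le_lt_trans (Vn _ _ Vz _) ne.
by have [] := WV _ (Wy n.+1).
Qed.

End fragmentability.

(** The bound at [- x] supplies the missing side of the estimate. *)
Lemma linear_le_norm_continuous (R : realType) (E : normedModType R)
    (f : {linear E -> R^o}) (c : R) :
  (forall x, f x <= c * `|x|) -> continuous f.
Proof.
move=> fc; apply: bounded_linear_continuous.
apply/linear_boundedP; exists c; split=> [|r cr x]; first exact: num_real.
rewrite ler_norml; apply/andP; split.
  rewrite lerNl -linearN; apply: le_trans (fc _) _.
  by rewrite normrN ler_wpM2r// ltW.
by apply: le_trans (fc x) _; rewrite ler_wpM2r// ltW.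
Qed.

(** * The universal property of the weak topology *)

Section weak_topology.
Context {R : realType} {E : completeNormedModType R}.

Lemma weak_topology_functional_continuous (f : topological_dual E) :
  continuous (sval f : weak_topology E -> R^o).
Proof.
move=> x.
have /cvg_sup/(_ f) fx : nbhs (x : weak_topology E) --> (x : weak_topology E).
  exact: cvg_id.
apply: cvg_trans (@initial_continuous E R^o (sval f) x).
exact: cvg_app fx.
Qed.

Lemma continuous_to_weak_topology (Y : topologicalType)
    (q : Y -> weak_topology E) :
  (forall f : topological_dual E, continuous (sval f \o q : Y -> R^o)) ->
  continuous q.
Proof.
move=> fq y; apply/cvg_sup => f.
exact: (@continuous_comp_initial E Y R^o (sval f) q (fq f)).
Qed.

End weak_topology.

Lemma eberlein_pi_base (R : realType) (Y : topologicalType) :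
  eberlein_compact R Y -> has_sigma_disjoint_pi_base Y.
Proof.
move=> [cY hY [E [K [cK [h [g [ch cg hK gK]]]]]]].
have cval : continuous (set_val : set_type K -> weak_topology E).
  exact: initial_continuous.
pose j (y : Y) : E := set_val (h y).
apply: (@fragmented_pi_base R E Y j cY hY) => [f f1 y|U y oU Uy].
  have cf : continuous f.
    by apply: (@linear_le_norm_continuous _ _ f 1) => x; rewrite mul1r.
  pose F : topological_dual E := exist _ f cf.
  apply: (@continuous_comp _ (weak_topology E) _ j (sval F)).
    by apply: continuous_comp; [exact: ch|exact: cval].
  exact: weak_topology_functional_continuous.
have : open (g @^-1` U) by move/continuousP: cg; apply.
move=> [W oW WU].
(* The norm topology refines the weak one, so a weakly open set around [j y] contains a norm
   ball. *)
have idc : continuous (id : E -> weak_topology E).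
  by apply: continuous_to_weak_topology => f; exact: (svalP f).
have : nbhs (j y) W.
  apply: idc; apply: open_nbhs_nbhs; split=> //.
  by rewrite -[W _]/((set_val @^-1` W) (h y)) WU/= hK.
move=> /nbhs_ballP[e /= e0 eW]; exists e => // z zy.
have : W (j z) by apply: eW; rewrite -ball_normE/= distrC.
by rewrite -[W _]/((set_val @^-1` W) (h z)) WU/= hK.
Qed.

(** * The absolute of a compact space *)

Lemma zero_dimensional_hausdorff (T : topologicalType) :
  zero_dimensional T -> hausdorff_space T.
Proof.
move=> zT; rewrite open_hausdorff => x y /zT[U [[oU cU] Ux Uy]].
exists (U, ~` U); first by rewrite !inE.
by split=> //=; [exact: closed_openC|rewrite setICr].
Qed.

Lemma compact_hausdorff_tychonoff (R : realType) (T : topologicalType) :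
  compact [set: T] -> hausdorff_space T -> tychonoff_space T.
Proof.
move=> cT hT; have aT := hausdorff_accessible hT.
split=> //; apply: (@normal_completely_regular R T) aT; exact: compact_normal.
Qed.

Lemma compact_set_type (T : topologicalType) (K : set T) :
  compact K -> compact [set: set_type K].
Proof.
move=> cK F FF _.
have FK : (set_val @ F) K.
  by apply: (@filterS _ F _ setT) => [x _|]; [exact: set_valP|exact: filterT].
have [p [Kp clp]] := cK (set_val @ F) (fmap_proper_filter _ FF) FK.
exists (SigSub (mem_set Kp)); split=> // A B FA [_ [[W oW <-] Wp] WB].
have FA' : (set_val @ F) (set_val @` A).
  by apply: (@filterS _ F _ A) => // a Aa; exists a.
have [_ [[a Aa <-] Wa]] := clp _ _ FA' (open_nbhs_nbhs (conj oW Wp)).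
by exists a; split=> //; exact: WB.
Qed.

Lemma compact_perfect_map (X Y : topologicalType) (f : X -> Y) :
  compact [set: X] -> hausdorff_space Y -> continuous f -> perfect_map f.
Proof.
move=> cX hY cf.
have clf (A : set X) : closed A -> compact A.
  by move=> cA; exact: (subclosed_compact cA cX (@subsetT _ A)).
split=> // [A /clf cA|y].
  apply: compact_closed => //; apply: continuous_compact => //.
  exact: continuous_subspaceT.
apply: clf; apply: preimage_closed => [x _|]; first exact: cf.
exact/accessible_closed_set1/hausdorff_accessible.
Qed.

(** A proper closed set misses some fibre contained in its complement, so its image misses a
    point. *)
Lemma irreducible_map_fiber (X Y : topologicalType) (f : X -> Y) :
  continuous f -> f @` [set: X] = [set: Y] ->
  (forall U, open U -> U !=set0 -> exists y, f @^-1` [set y] `<=` U) ->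
  irreducible_map f.
Proof.
move=> cf fT fU; split=> // A cA /eqP/setTPn[x nAx] fA.
have [|y yA] := fU _ (closed_openC cA); first by exists x.
have : [set: Y] y by [].
by rewrite -fA => -[a Aa fay]; exact: (yA a fay).
Qed.

Section absolute.
Variable X : topologicalType.

(* Ultrafilters of the lattice of open sets; the value at a set which is not
   open is irrelevant and normalized to [false]. *)
Definition open_ultrafilter : set (prod_topology (fun _ : set X => bool)) :=
  [set xi | [/\ xi set0 = false,
    forall U V, open U -> open V -> xi (U `&` V) = xi U && xi V,
    forall U, open U -> xi (~` closure U) = ~~ xi U &
    forall A, ~ open A -> xi A = false]].

Definition absolute : topologicalType := set_type open_ultrafilter.
Implicit Types xi eta : absolute.

Definition contains xi (U : set X) : bool := set_val xi U.

Lemma coord_clopen (A : set X) (b : bool) :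
  clopen [set xi : prod_topology (fun _ : set X => bool) | xi A = b].
Proof.
have cA : continuous
    (fun xi : prod_topology (fun _ : set X => bool) => xi A : bool).
  exact: (@proj_continuous _ (fun _ : set X => bool) A).
have cb : clopen [set b].
  by split; [exact: discrete_open|exact: discrete_closed].
exact: preimage_clopen cb cA.
Qed.

Lemma contains_clopen (U : set X) : clopen [set xi | contains xi U].
Proof.
exact: (@preimage_clopen absolute _ set_val _ (coord_clopen U true)
  (@initial_continuous _ _ _)).
Qed.

(** Each defining condition involves at most three coordinates, and a point of the closure agrees
    with some ultrafilter on any three. *)
Lemma closed_open_ultrafilter : closed open_ultrafilter.
Proof.
move=> xi clxi.
have close (A B C : set X) : exists z, [/\ open_ultrafilter z, z A = xi A,
    z B = xi B & z C = xi C].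
  have [|z [oz [eA [eB eC]]]] := clxi ([set z | z A = xi A] `&`
    ([set z | z B = xi B] `&` [set z | z C = xi C])).
    apply: open_nbhs_nbhs; split=> //.
    have coordo D := (coord_clopen D (xi D)).1.
    by apply: openI => //; exact: openI.
  by exists z.
split.
- by have [z [[e0 _ _ _] <- _ _]] := close set0 set0 set0.
- move=> U V oU oV; have [z [[_ eI _ _] <- <- <-]] := close (U `&` V) U V.
  exact: eI.
- move=> U oU; have [z [[_ _ eC _] <- <- _]] := close (~` closure U) U U.
  exact: eC.
- by move=> A nA; have [z [[_ _ _ e] <- _ _]] := close A A A; exact: e.
Qed.

Lemma compact_absolute : compact [set: absolute].
Proof.
apply: compact_set_type.
apply: (subclosed_compact closed_open_ultrafilter); last exact: subsetT.
have := @tychonoff (set X) (fun=> bool) (fun=> setT) (fun=> bool_compact).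
by congr compact; apply/seteqP; split.
Qed.

Lemma contains0 xi : contains xi set0 = false.
Proof. by have [] := set_valP xi. Qed.

Lemma containsI xi U V : open U -> open V ->
  contains xi (U `&` V) = contains xi U && contains xi V.
Proof. by have [_ + _ _] := set_valP xi; apply. Qed.

Lemma containsC xi U : open U -> contains xi (~` closure U) = ~~ contains xi U.
Proof. by have [_ _ + _] := set_valP xi; apply. Qed.

Lemma contains_nopen xi A : ~ open A -> contains xi A = false.
Proof. by have [_ _ _] := set_valP xi; apply. Qed.

Lemma containsT xi : contains xi setT.
Proof.
by have := containsC xi (@open0 X); rewrite closure0 setC0 contains0.
Qed.

Lemma containsS xi U V : open U -> open V -> U `<=` V ->
  contains xi U -> contains xi V.
Proof. by move=> oU oV /setIidPl UV; rewrite -{1}UV containsI// => /andP[]. Qed.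

Lemma contains_meets xi U V : open U -> open V ->
  contains xi U -> contains xi V -> U `&` V !=set0.
Proof.
move=> oU oV xU xV; apply/set0P/eqP => UV0.
by have := containsI xi oU oV; rewrite UV0 contains0 xU xV.
Qed.

(** Convergence of [G] is checked coordinatewise. For open [A], either [A] or its exterior is in
    [xi] and fixes the coordinate [A]; for other [A] that coordinate is constant. *)
Lemma absolute_base (W : set absolute) xi : open W -> W xi ->
  exists U, [/\ open U, contains xi U & [set eta | contains eta U] `<=` W].
Proof.
move=> [W' oW' <-] W'xi.
pose G : set_system (prod_topology (fun _ : set X => bool)) :=
  [set A | exists U, [/\ open U, contains xi U &
    forall eta, contains eta U -> A (set_val eta)]].
have GF : Filter G.
  split.
  - by exists setT; split=> //; [exact: openT|exact: containsT].
  - move=> A B [U [oU xU UA]] [V [oV xV VB]]; exists (U `&` V); split.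
    + exact: openI.
    + by rewrite containsI// xU.
    + by move=> eta; rewrite containsI// => /andP[/UA ? /VB].
  - move=> A B AB [U [oU xU UA]]; exists U; split=> // eta /UA; exact: AB.
suff : G --> (set_val xi : prod_topology (fun _ : set X => bool)).
  by move=> /(_ W' (open_nbhs_nbhs (conj oW' W'xi)))[U [oU xU UW]]; exists U.
apply/cvg_sup => A B [_ [[C oC <-] CxA] CB].
suff : G [set z | z A = set_val xi A].
  by apply: filterS => z zA; apply: CB; rewrite /= zA.
have [oA|nA] := pselect (open A); last first.
  exists setT; split; [exact: openT|exact: containsT|move=> eta _ /=].
  by rewrite -!/(contains _ _) !contains_nopen.
have [xA|xA] := boolP (contains xi A).
  by exists A; split=> // eta eA; rewrite /= -!/(contains _ _) eA.
exists (~` closure A); split.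
- exact/closed_openC/closed_closure.
- by rewrite containsC.
- move=> eta; rewrite containsC// => eA /=.
  by rewrite -!/(contains _ _) (negbTE eA) (negbTE xA).
Qed.

Lemma zero_dimensional_absolute : zero_dimensional absolute.
Proof.
move=> xi eta /eqP xe.
have [A xA] : exists A, contains xi A <> contains eta A.
  apply/existsNP => h; apply/xe/val_inj/funext => A; exact: h.
have [oU cU] := contains_clopen A.
case ex : (contains xi A) xA; case ee : (contains eta A) => // _.
  by exists [set x | contains x A]; split=> //=; rewrite ee.
exists (~` [set x | contains x A]); split=> //=; rewrite ?ex// ?ee//.
by split; [exact: closed_openC|exact: open_closedC].
Qed.

Lemma hausdorff_absolute : hausdorff_space absolute.
Proof. exact/zero_dimensional_hausdorff/zero_dimensional_absolute. Qed.

(** Neighbourhoods of [x] and dense open sets together generate a proper filter; the open members of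
    an ultrafilter [G] extending it form [xi]. The dense sets are there for the complement
    condition. *)
Lemma exists_ultrafilter_nbhs (x : X) :
  exists xi, forall W, open W -> W x -> contains xi W.
Proof.
pose F : set_system X := [set A | exists N D, [/\ open N, N x, open D, dense D &
  N `&` D `<=` A]].
have FF : ProperFilter F.
  split.
    move=> [N [D [oN Nx oD dD ND0]]].
    by have [|y /ND0] := dD N _ oN; first by exists x.
  split.
  - by exists setT, setT; split; rewrite ?setIT//; [exact: openT|exact: openT|
      move=> O [y Oy] _; exists y].
  - move=> A B [N [D [oN Nx oD dD NDA]]] [M [G [oM Mx oG dG MGB]]].
    exists (N `&` M), (D `&` G); split=> //.
    + exact: openI.
    + exact: openI.
    + move=> O O0 oO; rewrite setIA; apply: dG; last exact: openI.
      exact: dD.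
    + by move=> y [[Ny My] [Dy Gy]]; split; [exact: NDA|exact: MGB].
  - move=> A B AB [N [D [oN Nx oD dD NDA]]]; exists N, D; split=> //.
    exact: subset_trans AB.
have [G [GU FG]] := ultraFilterLemma FF.
pose xi (U : set X) := `[< open U /\ G U >].
have xiE U : open U -> xi U = `[< G U >].
  by move=> oU; apply/asboolP/asboolP => [[]|].
have G0 (A B : set X) : G A -> G B -> A `&` B !=set0.
  by move=> GA GB; exact: filter_ex (filterI GA GB).
have xiP : open_ultrafilter xi.
  split.
  - apply/negbTE/negP => /asboolP[_ G00].
    by have [y []] := G0 _ _ G00 G00.
  - move=> U V oU oV; rewrite !xiE//; last exact: openI.
    apply/asboolP/andP => [GUV|[/asboolP GU1 /asboolP GV]]; last exact: filterI.
    by split; apply/asboolP; apply: filterS GUV => y [].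
  - move=> U oU.
    have oC : open (~` closure U) by exact/closed_openC/closed_closure.
    rewrite !xiE// -asbool_neg; apply/asboolP/asboolP => [GC GU1|nGU].
      by have [y [Uy /(_ (subset_closure Uy))]] := G0 _ _ GU1 GC.
    (* The union of [U] and its exterior is dense and open, hence belongs to [G]. *)
    have GUC : G (U `|` ~` closure U).
      apply: FG; exists setT, (U `|` ~` closure U); split=> //.
      + exact: openT.
      + exact: openU.
      + move=> O [y Oy] oO; have [cy|ncy] := pselect (closure U y).
          have [z [Uz Oz]] := cy O (open_nbhs_nbhs (conj oO Oy)).
          by exists z; split=> //; left.
        by exists y; split=> //; right.
    have GnU : G (~` U) by have [/nGU[]|] := @in_ultra_setVsetC _ G U GU.
    by apply: filterS (filterI GUC GnU) => y [[|//] + ny] => /ny.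
  - by move=> A nA; apply/negbTE/negP => /asboolP[].
exists (SigSub (mem_set xiP)) => W oW Wx.
change (xi W); rewrite xiE//; apply/asboolP/FG.
by exists W, setT; split=> //; [exact: openT|move=> O [y Oy] _; exists y].
Qed.

Lemma exists_contains U : open U -> U !=set0 -> exists xi, contains xi U.
Proof.
move=> oU [x Ux]; have [xi xix] := exists_ultrafilter_nbhs x.
by exists xi; exact: xix.
Qed.

(** The closure of [W] is the clopen set given by the union [G] of all open [U] with basic set
    inside [W]: if [G] and [V] are in [xi], then [V] meets such a [U], and an ultrafilter containing
    both lies in [W]. *)
Lemma extremally_disconnected_absolute : extremally_disconnected absolute.
Proof.
move=> W oW; pose G := \bigcup_(U in [set U |
  open U /\ [set xi | contains xi U] `<=` W]) U.
have oG : open G by apply: bigcup_open => U [].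
suff -> : closure W = [set xi | contains xi G] by exact: (contains_clopen G).1.
apply/seteqP; split.
  apply: (@subset_trans _ (closure [set xi | contains xi G])); last first.
    by rewrite -(closure_id _).1//; exact: (contains_clopen G).2.
  apply: closureS => xi Wxi; have [U [oU xU UW]] := absolute_base oW Wxi.
  by apply: containsS xU => //; apply: bigcup_sup.
move=> xi xG A; rewrite nbhsE => -[B [oB Bx] BA].
have [V [oV xV VB]] := absolute_base oB Bx.
have [x [Vx [U [oU UW] Ux]]] := contains_meets oV oG xV xG.
have [|eta] := exists_contains (openI oV oU); first by exists x.
rewrite containsI// => /andP[eV eU].
by exists eta; split; [exact: UW|exact/BA/VB].
Qed.

Hypotheses (cX : compact [set: X]) (hX : hausdorff_space X).

(** The limit is a cluster point of the filter generated by [xi]. An open [W] around it but not in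
    [xi] would have its exterior in [xi], which misses [W]. *)
Lemma exists_ultrafilter_limit xi :
  exists x, forall W, open W -> W x -> contains xi W.
Proof.
pose F : set_system X :=
  [set A | exists U, [/\ open U, contains xi U & U `<=` A]].
have FF : ProperFilter F.
  split.
    move=> [U [oU xU U0]].
    by have [y [/U0]] := contains_meets oU oU xU xU.
  split.
  - by exists setT; split=> //; [exact: openT|exact: containsT].
  - move=> A B [U [oU xU UA]] [V [oV xV VB]]; exists (U `&` V); split.
    + exact: openI.
    + by rewrite containsI// xU.
    + exact: setISS.
  - move=> A B AB [U [oU xU UA]]; exists U; split=> //; exact: subset_trans AB.
have [x [_ clx]] := cX FF filterT.
exists x => W oW Wx; apply/negPn; rewrite -containsC//; apply/negP => xC.
have oC : open (~` closure W) by exact/closed_openC/closed_closure.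
have FC : F (~` closure W) by exists (~` closure W); split.
have [y [nWy Wy]] := clx _ _ FC (open_nbhs_nbhs (conj oW Wx)).
by apply: nWy; exact: subset_closure.
Qed.

Lemma is_absolute_absolute (R : realType) : is_absolute X absolute.
Proof.
split.
- exact: extremally_disconnected_absolute.
- exact: (compact_hausdorff_tychonoff R compact_absolute hausdorff_absolute).
have /choice[p pP] := exists_ultrafilter_limit.
have pcl xi U : open U -> contains xi U -> closure U (p xi).
  move=> oU xU; apply: contrapT => nU.
  have : contains xi (~` closure U).
    by apply: pP => //; exact/closed_openC/closed_closure.
  by rewrite containsC// xU.
have cp : continuous p.
  move=> xi A; rewrite nbhsE => -[B [oB Bx] BA].
  have [V [oV Vx VB]] := open_shrink cX hX oB Bx.
  apply: (@filterS _ (nbhs xi) _ [set eta | contains eta V]).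
    by move=> eta eV; apply/BA/VB/pcl.
  by apply: open_nbhs_nbhs; split; [exact: (contains_clopen V).1|exact: pP].
exists p; split; first exact: compact_perfect_map compact_absolute hX cp.
apply: irreducible_map_fiber => //.
(* An ultrafilter containing all open neighbourhoods of [x] has limit [x], since limits are unique
   in a Hausdorff space. *)
- apply/seteqP; split=> // x _; have [xi xiP] := exists_ultrafilter_nbhs x.
  exists xi => //; apply: hX => A B; rewrite !nbhsE.
  move=> [C [oC Cp] CA] [D [oD Dx] DB].
  have [y [Cy Dy]] := contains_meets oC oD (pP xi C oC Cp) (xiP D oD Dx).
  by exists y; split; [exact: CA|exact: DB].
(* For [x] in [V], every ultrafilter with limit [x] contains [V], so the fibre over [x] lies in the
   basic set of [V]. *)
- move=> U oU [xi Uxi]; have [V [oV xV VU]] := absolute_base oU Uxi.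
  have [x [Vx _]] := contains_meets oV oV xV xV.
  by exists x => eta /= ex; apply: VU => /=; apply: pP => //; rewrite ex.
Qed.

End absolute.

(** * Bounded families as a Banach space *)

Section linfty.
Context {R : realType} {I : Type}.

Definition bounded_family : {pred I -> R} :=
  fun x => `[< exists M, forall i, `|x i| <= M >].

Lemma bounded_family_submod_closed : submod_closed bounded_family.
Proof.
split.
  by apply/asboolP; exists 0 => i; rewrite normr0.
move=> a x y /asboolP[M xM] /asboolP[N yN]; apply/asboolP.
exists (`|a| * M + N) => i; rewrite /= (le_trans (ler_normD _ _))//.
by rewrite lerD// normrM ler_wpM2l.
Qed.

HB.instance Definition _ :=
  GRing.isSubmodClosed.Build R (I -> R) bounded_family
    bounded_family_submod_closed.

Record linfty := Linfty {
  linfty_val :> I -> R;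
  linfty_valP : linfty_val \in bounded_family }.

HB.instance Definition _ := [isSub for linfty_val].
HB.instance Definition _ := [Choice of linfty by <:].
HB.instance Definition _ := [SubChoice_isSubZmodule of linfty by <:].
HB.instance Definition _ := [SubZmodule_isSubLmodule of linfty by <:].

Implicit Types x y : linfty.

(** The adjoined 0 keeps the set nonempty when [I] is empty. *)
Definition linfty_norm x : R := sup (0 |` [set `|x i| | i in [set: I]]).

Lemma linfty_norm_has_sup x : has_sup (0 |` [set `|x i| | i in [set: I]]).
Proof.
split; first by exists 0; left.
have /asboolP[M xM] := linfty_valP x; exists (Num.max 0 M) => _ [->|[i _ <-]].
  by rewrite le_max lexx.
by rewrite le_max xM orbT.
Qed.

Lemma coord_le_norm x i : `|x i| <= linfty_norm x.
Proof. by apply: (ub_le_sup (linfty_norm_has_sup x).2); right; exists i. Qed.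

Lemma linfty_norm_le x (M : R) : 0 <= M -> (forall i, `|x i| <= M) ->
  linfty_norm x <= M.
Proof.
move=> M0 xM; apply: ge_sup; first by exists 0; left.
by move=> _ [->//|[i _ <-]].
Qed.

Lemma linfty_norm_ge0 x : 0 <= linfty_norm x.
Proof. by apply: (ub_le_sup (linfty_norm_has_sup x).2); left. Qed.

Lemma linfty_normD x y : linfty_norm (x + y) <= linfty_norm x + linfty_norm y.
Proof.
apply: linfty_norm_le => [|i]; first by rewrite addr_ge0// linfty_norm_ge0.
by rewrite (le_trans (ler_normD _ _))// lerD// coord_le_norm.
Qed.

Lemma linfty_normZ (a : R) x : linfty_norm (a *: x) = `|a| * linfty_norm x.
Proof.
have le b z : linfty_norm (b *: z) <= `|b| * linfty_norm z.
  apply: linfty_norm_le => [|i]; first by rewrite mulr_ge0// linfty_norm_ge0.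
  by rewrite normrM ler_wpM2l// coord_le_norm.
have [->|a0] := eqVneq a 0.
  apply/le_anti; rewrite normr0 mul0r linfty_norm_ge0 andbT.
  by have := le 0 x; rewrite normr0 mul0r.
apply/le_anti; rewrite le/= -ler_pdivlMl ?normr_gt0//.
by have := le a^-1 (a *: x); rewrite scalerA mulVf// scale1r normfV.
Qed.

Lemma linfty_norm0_eq0 x : linfty_norm x = 0 -> x = 0.
Proof.
move=> x0; apply/val_inj/funext => i; apply/eqP.
by rewrite -normr_le0 -x0 coord_le_norm.
Qed.

HB.instance Definition _ := Lmodule_isNormed.Build R linfty
  linfty_normD linfty_normZ linfty_norm0_eq0.

(** The limit [l] is taken coordinatewise; the estimate [lx] is uniform in [i], so it gives both
    boundedness of [l] and convergence in norm. *)
Lemma linfty_complete (F : set_system linfty) :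
  ProperFilter F -> cauchy F -> cvg F.
Proof.
move=> FF /cauchyP Fc.
have coord_dist i x y : `|x i - y i| <= `|x - y|.
  exact: coord_le_norm (x - y) i.
have /choice[l Fl] : forall i, exists l : R, (fun x : linfty => x i) @ F --> l.
  move=> i; apply/cvg_ex; apply: R_complete.
  apply/cauchyP => e e0; have [x Fx] := Fc e e0.
  exists (x i); apply: (@filterS linfty F _ (ball x e)) => // y.
  by rewrite -!ball_normE/=; exact: le_lt_trans.
have lx i (r : R) x : F (ball x r) -> `|l i - x i| <= r.
  move=> Fx; apply/ler_addgt0Pr => e e0.
  have /cvgrPdist_lt/(_ e e0) lFe := Fl i.
  have [y []] := filter_ex (filterI Fx lFe).
  rewrite -ball_normE/= => xy ly.
  rewrite -(subrK (y i) (l i)) -addrA (le_trans (ler_normD _ _))//.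
  rewrite (addrC r) lerD//.
    exact: ltW.
  by rewrite distrC ltW// (le_lt_trans (coord_dist i x y)).
have lb : l \in bounded_family.
  have [x Fx] := Fc 1 ltr01; apply/asboolP; exists (`|x| + 1) => i.
  rewrite -(subrK (x i) (l i)) addrC (le_trans (ler_normD _ _))// lerD//.
    exact: coord_le_norm.
  exact: lx.
apply/cvg_ex; exists (Linfty lb); apply/cvgrPdist_le => e e0.
have e20 : 0 < e / 2 by rewrite divr_gt0.
have [x Fx] := Fc _ e20; apply: filterS (Fx) => y.
rewrite -ball_normE/= => xy; rewrite -(subrK x (Linfty lb)) -addrA.
rewrite (le_trans (ler_normD _ _))// (splitr e) lerD//; last exact: ltW.
by apply: linfty_norm_le => [|i]; [exact: ltW|exact: lx].
Qed.

HB.instance Definition _ := Uniform_isComplete.Build linfty linfty_complete.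

End linfty.
Arguments linfty : clear implicits.

Lemma continuous_functional_bound (R : realType) (E : normedModType R)
    (f : {linear E -> R^o}) : continuous f ->
  exists2 M : R, 0 <= M & forall x, `|f x| <= M * `|x|.
Proof.
move=> /linear_bounded_continuous/linear_boundedP[M [_ fM]].
exists (Num.max 0 M + 1) => [|x]; first by rewrite addr_ge0// le_max lexx.
by apply: fM; rewrite ltr_pwDr// le_max lexx orbT.
Qed.

(** * Values of functionals on coordinate unit vectors *)

Section linfty_functionals.
Context {R : realType} {I : choiceType}.
Local Notation E := (linfty R I).

Lemma bounded_family_bool (b : I -> bool) :
  (fun i => (b i)%:R : R) \in bounded_family.
Proof.
by apply/asboolP; exists 1 => i; case: (b i); rewrite ?normr1 ?normr0.
Qed.

Definition linfty_indic (b : I -> bool) : E := Linfty (bounded_family_bool b).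

Definition linfty_coord (i : I) (x : E) : R^o := x i.

Lemma coord_linear i : linear_for *:%R (linfty_coord i).
Proof. by []. Qed.

HB.instance Definition _ i :=
  GRing.isLinear.Build R E R^o *:%R (linfty_coord i) (coord_linear i).

Lemma coord_continuous i : continuous (linfty_coord i).
Proof.
apply: (@linear_le_norm_continuous _ _ _ 1) => x.
by rewrite mul1r (le_trans (ler_norm _))// coord_le_norm.
Qed.

(** The vector is the sum of the unit vectors over [s], each with the sign of its value under [f]:
    disjoint supports keep the norm at most 1 while the absolute values add up. *)
Lemma signed_unit_vectors (f : {linear E -> R^o}) (e : R) (s : seq I) :
  uniq s ->
  (forall i, i \in s -> e <= `|f (linfty_indic (pred1 i))|) ->
  exists x : E, [/\ `|x| <= 1, forall i, i \notin s -> x i = 0 &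
    (size s)%:R * e <= f x].
Proof.
elim: s => [_ _|i s IH /= /andP[nis us] fe].
  by exists 0; rewrite normr0 linear0 mul0r.
have [k ks|x [x1 xs fx]] := IH us; first by apply: fe; rewrite inE ks orbT.
have fei := fe i (mem_head _ _).
pose u := linfty_indic (pred1 i).
exists (x + Num.sg (f u) *: u); split.
- apply: linfty_norm_le => // t.
  rewrite -[X in `|X|]/(x t + Num.sg (f u) * (t == i)%:R).
  have [->|ti] := eqVneq t i.
    by rewrite xs// add0r mulr1 normr_sg; case: eqP.
  by rewrite mulr0 addr0 (le_trans (coord_le_norm x t)).
- move=> t; rewrite inE negb_or => /andP[ti ts].
  rewrite -[LHS]/(x t + Num.sg (f u) * (t == i)%:R).
  by rewrite xs// (negbTE ti) mulr0 addr0.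
- have -> : f (x + Num.sg (f u) *: u) = f x + `|f u|.
    by rewrite linearD linearZ/= normrEsg.
  by rewrite -natr1 mulrDl mul1r; exact: lerD.
Qed.

(** More than [M / e] such indices would yield a vector of norm at most 1 at which [f] exceeds its
    bound [M]. *)
Lemma finite_large_unit_vectors (f : {linear E -> R^o}) (e : R) :
  continuous f -> 0 < e ->
  finite_set [set i | e <= `|f (linfty_indic (pred1 i))|].
Proof.
move=> /continuous_functional_bound[M M0 fM] e0; apply: contrapT.
move=> /(@infinite_set_fset _ _ (Num.trunc (M / e)).+1)[B BA sB].
have [i iB|x [x1 _ fx]] :=
    @signed_unit_vectors f e (enum_fset B) (fset_uniq B).
  exact: (BA i iB).
have : (size (enum_fset B))%:R * e <= M.
  apply: (le_trans fx); apply: le_trans (ler_norm _) _.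
  by apply: (le_trans (fM x)); rewrite ler_piMr.
apply/negP; rewrite -ltNge -ltr_pdivrMr//.
by rewrite (lt_le_trans (truncnS_gt _))// ler_nat.
Qed.

End linfty_functionals.

(** * A zero-dimensional Eberlein compact from a sigma-disjoint pi-base *)

Section ultrafilter_embedding.
Context {R : realType} {X : topologicalType} (F : nat -> set (set X)).
Hypothesis F_open : forall n V, F n V -> open V.
Hypothesis F_disjoint : forall n, trivIset (F n) id.
Local Notation E := (linfty R (nat * set X)%type).
Implicit Types xi eta : absolute X.

Definition chosen xi (i : nat * set X) := `[< F i.1 i.2 >] && contains xi i.2.

Lemma chosen_inj xi n U V : chosen xi (n, U) -> chosen xi (n, V) -> U = V.
Proof.
move=> /andP[/asboolP/= FU xU] /andP[/asboolP/= FV xV].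
apply: (@F_disjoint n) => //.
exact: contains_meets (F_open FU) (F_open FV) xU xV.
Qed.

(** Level [n] of [embedding] without its weight; by disjointness of [F n] it is a coordinate unit
    vector or zero. *)
Definition slice n xi : E := linfty_indic (fun i => (i.1 == n) && chosen xi i).

Lemma slice_chosen n xi V : chosen xi (n, V) ->
  slice n xi = linfty_indic (pred1 (n, V)).
Proof.
move=> xV; apply/val_inj/funext => -[m U] /=; congr (nat_of_bool _)%:R.
apply/andP/eqP => [[/eqP -> xU]|[-> ->]]; last by rewrite eqxx.
by rewrite (chosen_inj xU xV).
Qed.

Lemma slice0 n xi : (forall V, ~~ chosen xi (n, V)) -> slice n xi = 0.
Proof.
move=> nx; apply/val_inj/funext => -[m U] /=.
by case: eqP => [->|//]; rewrite (negbTE (nx U)).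
Qed.

(** If [xi] contains a member of [F n], the slice is constant near [xi]. Otherwise it is 0 at [xi],
    and only finitely many members give values of size at least [e]; a neighbourhood of [xi]
    excludes them all. *)
Lemma slice_continuous (f : {linear E -> R^o}) n : continuous f ->
  continuous (f \o slice n : absolute X -> R^o).
Proof.
move=> cf xi; have Fxi : Filter (nbhs xi) by exact: nbhs_filter.
have nbhs_contains V : contains xi V -> nbhs xi [set eta | contains eta V].
  by move=> xV; apply: open_nbhs_nbhs; split=> //; exact: (contains_clopen V).1.
have [[V xV]|nV] := pselect (exists V, chosen xi (n, V)).
  apply: (@cvg_near_cst _ R^o _ _ (nbhs xi) Fxi).
  have /andP[FV xiV] := xV.
  apply: (@filterS _ (nbhs xi) _ _ _ _ (nbhs_contains _ xiV)) => eta eV.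
  by rewrite /= !(slice_chosen (V := V))//; apply/andP.
have {}nV V : ~~ chosen xi (n, V) by apply/negP => xV; apply: nV; exists V.
apply/cvgrPdist_lt => e e0; rewrite /= (slice0 nV) linear0.
pose bad := [set V | F n V /\ e <= `|f (linfty_indic (pred1 (n, V)))|].
have bad_fin : finite_set bad.
  have := finite_large_unit_vectors cf e0.
  move=> /(finite_image snd); apply: sub_finite_set => V [_ eV].
  by exists (n, V).
have /finite_fsetP[B BE] := bad_fin.
have : nbhs xi (\bigcap_(V in [set` B]) ~` [set eta | contains eta V]).
  apply: filter_bigI => V BV; have [FV _] : bad V by rewrite BE.
  apply: open_nbhs_nbhs; split.
    exact/closed_openC/(contains_clopen V).2.
  by move=> xV; move: (nV V); rewrite /chosen/= xV andbT => /asboolP.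
rewrite -BE; apply: filterS => eta eb /=; rewrite sub0r normrN.
have [[V eV]|neta] := pselect (exists V, chosen eta (n, V)); last first.
  rewrite slice0 ?linear0 ?normr0// => V.
  by apply/negP => eV; apply: neta; exists V.
rewrite (slice_chosen eV) ltNge; apply/negP => le.
have /andP[/asboolP/= FV etaV] := eV.
exact: eb V (conj FV le) etaV.
Qed.

(** The predicate [P] is left free to serve both [embedding] and [truncation]. *)
Lemma embedding_bounded (P : pred (nat * set X)) :
  (fun i => (P i)%:R / i.1.+1%:R : R) \in bounded_family.
Proof.
apply/asboolP; exists 1 => i; case: (P i); last by rewrite mul0r normr0.
by rewrite mul1r ger0_norm// invf_le1// ler1n.
Qed.

Definition embedding xi : E := Linfty (embedding_bounded (chosen xi)).

Definition truncation N xi : E :=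
  Linfty (embedding_bounded (fun i => (i.1 < N)%N && chosen xi i)).

(** Each step adds one weighted slice, so induction on [N] applies. *)
Lemma truncation_continuous (f : {linear E -> R^o}) N : continuous f ->
  continuous (f \o truncation N : absolute X -> R^o).
Proof.
move=> cf; elim: N => [|N IH].
  rewrite (_ : _ \o _ = cst 0); first exact: cst_continuous.
  apply/funext => xi /=; rewrite (_ : truncation 0 xi = 0) ?linear0//.
  by apply/val_inj/funext => i /=; rewrite mul0r.
rewrite (_ : _ \o _ =
  fun xi => f (truncation N xi) + N.+1%:R^-1 * f (slice N xi)).
  move=> xi; have Fxi : Filter (nbhs xi) by exact: nbhs_filter.
  have fN : (f \o truncation N) eta @[eta --> xi] -->
    (f (truncation N xi) : R) by exact: IH.
  have fs : (f \o slice N) eta @[eta --> xi] -->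
    (f (slice N xi) : R) by exact: slice_continuous.
  exact: cvgD fN (cvgM (cvg_cst _) fs).
apply/funext => xi /=; rewrite -[_ * _]/(N.+1%:R^-1 *: f (slice N xi)).
rewrite -linearZ -linearD; congr (f _); apply/val_inj/funext => -[m V] /=.
rewrite -[RHS]/((((m < N)%N && chosen xi (m, V))%:R / m.+1%:R) +
  N.+1%:R^-1 * ((m == N) && chosen xi (m, V))%:R) ltnS leq_eqVlt.
have [->|mN] := eqVneq m N; last by rewrite /= mulr0 addr0.
by rewrite ltnn /= mul0r add0r mulrC.
Qed.

Lemma truncation_dist N xi : `|embedding xi - truncation N xi| <= N.+1%:R^-1.
Proof.
apply: linfty_norm_le => [|[m V]]; first by rewrite invr_ge0.
rewrite -[X in `|X|]/((chosen xi (m, V))%:R / m.+1%:R -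
  ((m < N)%N && chosen xi (m, V))%:R / m.+1%:R).
case: ltnP => [_|Nm] /=; first by rewrite subrr normr0 invr_ge0.
rewrite mul0r subr0; case: (chosen _ _); last by rewrite mul0r normr0 invr_ge0.
by rewrite mul1r ger0_norm// lef_pV2 ?posrE// ler_nat.
Qed.

(** A uniform limit of the continuous functions given by the truncations. *)
Lemma embedding_continuous (f : {linear E -> R^o}) : continuous f ->
  continuous (f \o embedding : absolute X -> R^o).
Proof.
move=> cf xi; have Fxi : Filter (nbhs xi) by exact: nbhs_filter.
have [M M0 fM] := continuous_functional_bound cf.
apply/cvgrPdist_lt => e e0; have e30 : 0 < e / 3 by rewrite divr_gt0.
(* This makes [M / N.+1] smaller than [e / 3]. *)
pose N := Num.trunc (M / (e / 3)).
have MN eta : `|f (embedding eta) - f (truncation N eta)| < e / 3.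
  rewrite -linearB (le_lt_trans (fM _))//.
  apply: (@le_lt_trans _ _ (M * N.+1%:R^-1)).
    by rewrite ler_wpM2l// truncation_dist.
  by rewrite ltr_pdivrMr// mulrC -ltr_pdivrMr// truncnS_gt.
have /cvgrPdist_lt/(_ _ e30) := @truncation_continuous f N cf xi.
apply: filterS => eta /= xe.
have := MN xi; have := MN eta; move: xe; rewrite !ltr_norml.
by move=> /andP[? ?] /andP[? ?] /andP[? ?]; apply/andP; split; lra.
Qed.

(** * The image as a zero-dimensional Eberlein compact *)

Definition eberlein_model : set (weak_topology E) := range embedding.

Let Y : topologicalType := set_type eberlein_model.

Definition to_model xi : Y :=
  SigSub (mem_set (imageP embedding (I : [set: absolute X] xi))).

Lemma to_model_continuous : continuous to_model.
Proof.
apply: (@continuous_comp_initial Y (absolute X) (weak_topology E) set_val).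
apply: continuous_to_weak_topology => f.
exact: embedding_continuous (svalP f).
Qed.

Lemma to_model_surjective : to_model @` [set: absolute X] = [set: Y].
Proof.
apply/seteqP; split=> // y _; have [xi _ xiy] := set_valP y.
by exists xi => //; apply/val_inj.
Qed.

Lemma to_model_chosen xi eta i : to_model xi = to_model eta ->
  chosen xi i = chosen eta i.
Proof.
move=> /(congr1 (fun y : Y => (set_val y : E) i)) /=.
have n0 : i.1.+1%:R^-1 != 0 :> R by rewrite invr_neq0// pnatr_eq0.
case: (chosen xi i); case: (chosen eta i) => //=; rewrite mul0r mul1r => /eqP.
  by rewrite (negbTE n0).
by rewrite eq_sym (negbTE n0).
Qed.

Lemma compact_model : compact [set: Y].
Proof.
rewrite -to_model_surjective.
apply: continuous_compact; last exact: compact_absolute.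
exact/continuous_subspaceT/to_model_continuous.
Qed.

Lemma model_coord_continuous i :
  continuous (fun y : Y => linfty_coord i (set_val y : E)).
Proof.
pose c : topological_dual E :=
  exist _ (linfty_coord i : {linear E -> R^o}) (@coord_continuous R _ i).
move=> y; apply: (@continuous_comp Y (weak_topology E) R^o set_val (sval c)).
  exact: initial_continuous.
exact: weak_topology_functional_continuous.
Qed.

Lemma to_modelP (y : Y) : exists xi, to_model xi = y.
Proof.
have : [set: Y] y by [].
by rewrite -to_model_surjective => -[xi _ <-]; exists xi.
Qed.

(** Coordinate [i] only takes the values 0 and [i.1.+1%:R^-1], so failing to be positive is the open
    condition of lying below the latter. *)
Lemma positive_coord_clopen i :
  clopen [set y : Y | 0 < linfty_coord i (set_val y)].
Proof.
have /continuousP ci := @model_coord_continuous i.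
split; first exact: (ci [set r | 0 < r] (@open_gt _ _)).
rewrite -[X in closed X]setCK; apply: open_closedC.
suff -> : ~` [set y : Y | 0 < linfty_coord i (set_val y)] =
    [set y | linfty_coord i (set_val y) < i.1.+1%:R^-1].
  exact: (ci [set r | r < _] (@open_lt _ _)).
apply/seteqP; split=> u /=; have [xi <-] := to_modelP u.
  move/negP; rewrite -leNgt => /le_lt_trans; apply.
  by rewrite invr_gt0.
rewrite /linfty_coord/=; case: (chosen xi i); first by rewrite mul1r ltxx.
by rewrite mul0r ltxx.
Qed.

Lemma zero_dimensional_model : zero_dimensional Y.
Proof.
move=> y z /eqP yz.
have [i] : exists i, linfty_coord i (set_val y) <> linfty_coord i (set_val z).
  by apply/existsNP => h; apply/yz/val_inj/val_inj/funext => i; exact: h.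
have := positive_coord_clopen i; set U := [set _ | _] => Ucl.
have [xi yE] := to_modelP y; have [eta zE] := to_modelP z.
have val_chosen t :
  linfty_coord i (set_val (to_model t)) = (chosen t i)%:R / i.1.+1%:R by [].
have Ut t : U (to_model t) = is_true (chosen t i).
  rewrite -[U _]/(is_true (0 < linfty_coord i (set_val (to_model t)))).
  rewrite val_chosen; congr is_true.
  by case: (chosen t i); rewrite ?mul1r ?mul0r ?ltxx// invr_gt0 ltr0n.
rewrite -yE -zE !val_chosen.
case cx : (chosen xi i); case ce : (chosen eta i) => // _.
  by exists U; rewrite !Ut cx ce.
exists (~` U); split; rewrite /= ?Ut ?cx ?ce//.
by case: Ucl => oU cU; split; [exact: closed_openC|exact: open_closedC].
Qed.

Lemma hausdorff_model : hausdorff_space Y.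
Proof. exact/zero_dimensional_hausdorff/zero_dimensional_model. Qed.

Lemma model_has_clopen_base : has_clopen_base Y.
Proof.
exists clopen => //; split=> [U []//|y A Ay].
have [U [Uy clU] UA] := zero_dimensional_cvg (x := y) hausdorff_model
  zero_dimensional_model compact_model Ay.
by exists U.
Qed.

Lemma eberlein_compact_model : eberlein_compact R Y.
Proof.
split; [exact: compact_model|exact: hausdorff_model|].
exists E, eberlein_model; split.
  have -> : eberlein_model = (set_val : Y -> weak_topology E) @` [set: Y].
    apply/seteqP; split=> [x Kx|_ [y _ <-]]; last exact: set_valP.
    by exists (SigSub (mem_set Kx)).
  apply: continuous_compact; last exact: compact_model.
  exact/continuous_subspaceT/initial_continuous.
by exists id, id; split=> // y; exact: cvg_id.
Qed.

Hypotheses (cX : compact [set: X]) (hX : hausdorff_space X).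
Hypothesis F_pi_base : pi_base (\bigcup_n F n).

(** [absolute X] serves as the absolute of both spaces. For irreducibility, a basic set given by [W]
    contains a whole fibre: take [V] in some [F n] inside [W] and [eta] containing [V]; every
    ultrafilter with the same image contains [V], hence [W]. *)
Lemma co_absolute_model : co_absolute X Y.
Proof.
exists (absolute X), (absolute X); split.
- exact: (is_absolute_absolute cX hX R).
- have [eX tX _] := is_absolute_absolute cX hX R; split=> //.
  exists to_model; split.
    exact: compact_perfect_map (@compact_absolute X) hausdorff_model
      to_model_continuous.
  apply: irreducible_map_fiber to_model_continuous to_model_surjective _.
  move=> U oU [xi Uxi]; have [W [oW xW WU]] := absolute_base oU Uxi.
  have [x [Wx _]] := contains_meets oW oW xW xW.
  have [|V [[n _ FV] V0 VW]] := F_pi_base.2 W oW; first by exists x.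
  have oV := F_open FV; have [eta eV] := exists_contains oV V0.
  exists (to_model eta) => t /= /(to_model_chosen (n, V)) tV; apply: WU => /=.
  apply: (containsS oV oW VW).
  have : chosen eta (n, V) by apply/andP; split=> //; exact/asboolP.
  by rewrite -tV => /andP[].
- by exists id, id; split=> // y; exact: cvg_id.
Qed.

End ultrafilter_embedding.

Theorem theorem6p8 (R : realType) (X : topologicalType)
    (compactX : compact [set: X]) (hausdorffX : hausdorff_space X) :
  [<-> exists Y : topologicalType, eberlein_compact R Y /\ co_absolute X Y;
       exists B : set (set X), pi_base B /\ sigma_disjoint B;
       exists Y : topologicalType,
         [/\ eberlein_compact R Y, has_clopen_base Y & co_absolute X Y]].
Proof.
tfae.
- by move=> [Y [/eberlein_pi_base hY /co_absolute_pi_base]]; apply.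
- move=> [B [piB [F [BF tF]]]].
  have Fo n V : F n V -> open V.
    by move=> FV; apply: piB.1; rewrite BF; exists n.
  rewrite BF in piB.
  exists (set_type (@eberlein_model R X F)); split.
  + exact: eberlein_compact_model Fo tF.
  + exact: model_has_clopen_base Fo tF.
  + exact: co_absolute_model Fo tF compactX hausdorffX piB.
- by move=> [Y [eY _ cY]]; exists Y.
Qed.
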